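(* Let $a,b\ge 2$ be integers with $\gcd(a,b)=1$, and let $k$ be a positive integer. Suppose that $k$ divides $(a-1)(b-1)$, and put $M_k:=\frac{(a-1)(b-1)}{k}$. Then at most one of the two equations $$ax+by=M_k\qquad\text{and}\qquad 1+ax+by=M_k$$ is solvable. When one of them is solvable, its nonnegative integral solution $(x,y)$ is unique.
   Context: An equation in the unknowns $x,y$ is called solvable if it has a solution with $x,y$ nonnegative integers. *)

(* Defs.v *)
From mathcomp Require Import all_boot.

Set Implicit Arguments.
Unset Strict Implicit.
Unset Printing Implicit Defensive.

(* An equation in two unknowns is given as a relation on nat, so that a
   solution is by construction a pair of nonnegative integers. *)
Definition solvable (E : nat -> nat -> Prop) : Prop :=
  exists x y : nat, E x y.

Definition unique_solution (E : nat -> nat -> Prop) : Prop :=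
  exists! p : nat * nat, E p.1 p.2.

(* Meaningful when k divides (a - 1) * (b - 1): the quotient is then exact. *)
Definition M (a b k : nat) : nat := ((a - 1) * (b - 1)) %/ k.

Definition eqn0 (a b k x y : nat) : Prop := a * x + b * y = M a b k.

Definition eqn1 (a b k x y : nat) : Prop := 1 + a * x + b * y = M a b k.

(* Main.v *)
Require Import Defs.
From mathcomp Require Import all_boot.
From mathcomp Require Import zify.

(** Both [a] and [b] are at least 2, and [M = M a b k] satisfies
    [k * M = (a - 1) * (b - 1) < a * b].

    Uniqueness: two representations [a * x + b * y] of a number smaller than
    [a * b] have [x]-coordinates smaller than [b] and congruent modulo [b], since
    [a] is invertible modulo [b]; hence they agree.

    Incompatibility: suppose that [a * x + b * y = M = 1 + a * x' + b * y'].
    Then [x' < x] or [y' < y], and by symmetry we may take [x' < x].  The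
    equality [k * M = (a - 1) * (b - 1)] reads
    [a * (k * x + 1) + b * (k * y + 1) = 1 + a * b], so [k * x + 1] is the
    inverse of [a] modulo [b] lying below [b].  But
    [a * (x - x') + b * y = 1 + b * y'] makes [x - x'] such an inverse too, and
    [x - x' < k * x + 1]: a contradiction. *)

Lemma coprime_mul_modn_inj (a b u v : nat) :
  coprime b a -> u < b -> v < b -> a * u = a * v %[mod b] -> u = v.
Proof.
move=> cba; wlog le_vu : u v / v <= u => [IH|] ltu ltv /eqP eq_uv.
  case/orP: (leq_total v u) => [le|le]; first by apply: IH => //; apply/eqP.
  by apply/esym/IH => //; apply/esym/eqP.
move: eq_uv; rewrite eqn_mod_dvd ?leq_mul2l ?le_vu ?orbT //.
rewrite -mulnBr Gauss_dvdr // => /dvdn_leq; lia.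
Qed.

Lemma coprime_lincomb_inj (a b x y x' y' : nat) :
  coprime b a -> a * x + b * y < a * b ->
  a * x + b * y = a * x' + b * y' -> x = x' /\ y = y'.
Proof.
move=> cba lt_ab E.
have Ex : x = x'.
  apply: (coprime_mul_modn_inj a b) => //.
  - have : a * x < a * b by lia.
    by rewrite ltn_mul2l => /andP[].
  - have : a * x' < a * b by lia.
    by rewrite ltn_mul2l => /andP[].
  by rewrite -(modnMDl y) -[RHS](modnMDl y') ![_ * b]mulnC ![b * _ + _]addnC E.
split=> //; subst x'; move/addnI/eqP: E; rewrite eqn_mul2l.
by case/orP=> /eqP // b0; move: lt_ab; rewrite b0 muln0.
Qed.

(** Half of the incompatibility of the two equations; the other half follows
    by exchanging the roles of [a] and [b]. *)
Lemma lincomb_succ_coord_le (a b k x y x' y' : nat) :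
  coprime b a -> 2 <= b -> 0 < k ->
  a * (k * x + 1) + b * (k * y + 1) = 1 + a * b ->
  a * x + b * y = 1 + a * x' + b * y' -> x <= x'.
Proof.
move=> cba hb hk Ek E; rewrite leqNgt; apply/negP => lt_x.
have lt_kx : k * x + 1 < b.
  have le_b : b <= b * (k * y + 1) by rewrite leq_pmulr ?addn1.
  have : a * (k * x + 1) < a * b by lia.
  by rewrite ltn_mul2l => /andP[].
have le_x : x <= k * x by rewrite leq_pmull.
suff: k * x + 1 = x - x' by lia.
apply: (coprime_mul_modn_inj a b) => //; first by lia.
(* Both products are congruent to 1 modulo b. *)
transitivity (1 %% b).
  rewrite -(modnMDl (k * y + 1)) -[RHS](modnMDl a).
  by congr (_ %% b); lia.
have le_ax : a * x' <= a * x by rewrite leq_mul2l (ltnW lt_x) orbT.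
rewrite -(modnMDl y') -[RHS](modnMDl y) mulnBr.
by congr (_ %% b); lia.
Qed.

Theorem theorem1p4 (a b k : nat) (ha : 2 <= a) (hb : 2 <= b)
    (hab : gcdn a b = 1) (hk : 0 < k) (hdvd : k %| (a - 1) * (b - 1)) :
  ~ (solvable (eqn0 a b k) /\ solvable (eqn1 a b k)) /\
  (solvable (eqn0 a b k) -> unique_solution (eqn0 a b k)) /\
  (solvable (eqn1 a b k) -> unique_solution (eqn1 a b k)).
Proof.
have cab : coprime a b by rewrite /coprime hab.
have cba : coprime b a by rewrite coprime_sym.
have EM : M a b k * k = (a - 1) * (b - 1) by rewrite /M divnK.
have Eab : (a - 1) * (b - 1) + a + b = 1 + a * b.
  by rewrite mulnBl mulnBr; have := leq_mul ha hb; nia.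
have lt_M : M a b k < a * b.
  by apply: leq_ltn_trans (leq_div _ _) _; lia.
split; last split.
- case=> [[x [y E0]] [x' [y' E1]]]; rewrite /eqn0 in E0; rewrite /eqn1 in E1.
  have Ek : a * (k * x + 1) + b * (k * y + 1) = 1 + a * b.
    by rewrite -E0 in EM; lia.
  have le_x : x <= x' by apply: (lincomb_succ_coord_le a b k x y x' y'); lia.
  have le_y : y <= y' by apply: (lincomb_succ_coord_le b a k y x y' x'); lia.
  have := leq_mul (leqnn a) le_x; have := leq_mul (leqnn b) le_y; lia.
- case=> x [y E]; exists (x, y); split=> // -[x' y'] /= E'.
  rewrite /eqn0 in E E'.
  have [||-> ->] // := coprime_lincomb_inj a b x y x' y' cba; lia.
- case=> x [y E]; exists (x, y); split=> // -[x' y'] /= E'.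
  rewrite /eqn1 in E E'.
  have [||-> ->] // := coprime_lincomb_inj a b x y x' y' cba; lia.
Qed.
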